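(* In the setting described in the context, the average over $m\in\{0,1,\dots,2n-3\}$ of the total traveling distances of the schedules $K^*_{\mathrm{DRR}}(m)$ is at most \[(n-2)\tau' + 2\sum_{v\in V\setminus\{v^*\}} d_{vv^*} + \tfrac{3}{2}\tau + \tfrac{n\tau}{2} + \frac{1}{n-1}\sum_{v\in V}\sum_{v'\in V\setminus\{v\}} d_{vv'},\] where $\tau$ is the length of a shortest Hamilton cycle of $G$ and $\tau'$ is the length of the Hamilton cycle $(v_0,\dots,v_{n-2})$.
   Context: Teams and distances: $n\ge4$ even teams, each with a home venue; $d_{ij}\ge0$ is the distance between the home venues of teams $i,j$, with $d_{ii}=0$, symmetry and the triangle inequality. $G$ is the complete graph on the set $V$ of home venues, edge $\{v,v'\}$ having length $d_{vv'}$. A game ''$i$ at $j$'' is played at $j$'s venue (home for $j$, away for $i$). A double round-robin schedule has slots $0,\dots,2n-3$, each team plays exactly one game per slot, and every ordered pair of distinct teams is played exactly once. The traveling distance of a team: it starts at its home venue, travels in slot order to the venues of its games, and returns home after the last slot; the total traveling distance is the sum over teams. Construction: $v^*$ is a vertex attaining $\min_{v\in V}\sum_{v'\in V\setminus\{v\}}d_{vv'}$, and its team is named $n-1$. $(v_0,\dots,v_{n-2})$ is the Hamilton cycle on $V\setminus\{v^*\}$ produced by Christofides' 1.5-approximation algorithm, and the team with home venue $v_i$ is named $i$. For $t\in\{0,\dots,n-1\}$, $s\in\{0,\dots,n-2\}$: $K^*(t,s)=s-t\pmod{n-1}$ if $t\ne n-1$ and $s-t\not\equiv t\pmod{n-1}$;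 $K^*(t,s)=n-1$ if $t\ne n-1$ and $s-t\equiv t\pmod{n-1}$; $K^*(n-1,s)=s/2$ for $s$ even and $(s+n-1)/2$ for $s$ odd. $K^*_{\mathrm{DRR}}$: in slots $s$ and $s+n-1$ ($0\le s\le n-2$) team $t$ plays $K^*(t,s)$; for $t\in\{0,\dots,n/2-1\}$ its games in slots $2t,\dots,n+2t-2$ are home and the others away; for $t\in\{n/2,\dots,n-2\}$ its games in slots $2t-n+2,\dots,2t$ are away and the others home; team $n-1$ plays away in slots $0,\dots,n-2$ and home otherwise. $K^*_{\mathrm{DRR}}(m)$ ($0\le m\le 2n-3$) has in slot $s$ the games of $K^*_{\mathrm{DRR}}$ in slot $s+m\pmod{2n-2}$. *)

(* Defs.v *)
From mathcomp Require Import all_boot all_order all_algebra.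
Set Implicit Arguments.
Unset Strict Implicit.
Unset Printing Implicit Defensive.
Import Order.TTheory GRing.Theory Num.Theory.
Local Open Scope ring_scope.

(* The values of [f] along the steps of the closed walk w_0, ..., w_k, w_0.   *)
Definition closed_steps (V A : Type) (f : V -> V -> A) (w : seq V) : seq A :=
  if w is x :: w' then pairmap f x (rcons w' x) else [::].

Definition closed_len (R : nmodType) (V : Type) (d : V -> V -> R) (w : seq V) : R :=
  \sum_(l <- closed_steps d w) l.

(* Hamilton cycle of the complete graph on S, listed from any start vertex.   *)
Definition hamilton_cycle (V : finType) (S : {set V}) (c : seq V) : Prop :=
  uniq c /\ c =i S.

Definition shortest_hamilton_cycle (R : realFieldType) (V : finType)
    (d : V -> V -> R) (S : {set V}) (c : seq V) : Prop :=
  hamilton_cycle S c /\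
  forall c', hamilton_cycle S c' -> closed_len d c <= closed_len d c'.

(** Christofides' algorithm.  An undirected edge {x, y} is the set [set x; y],
    a simple graph is a set of edges, a multigraph is a list of edges.        *)

(* For x != y, d symmetric and d x x = 0, this is d x y on [set x; y].        *)
Definition edge_len (R : realFieldType) (V : finType) (d : V -> V -> R)
    (e : {set V}) : R :=
  (\sum_(x in e) \sum_(y in e) d x y) / 2.

Definition graph_len (R : realFieldType) (V : finType) (d : V -> V -> R)
    (E : {set {set V}}) : R :=
  \sum_(e in E) edge_len d e.

Definition adj (V : finType) (E : {set {set V}}) : rel V :=
  [rel x y | [set x; y] \in E].

Definition degree (V : finType) (E : {set {set V}}) (v : V) : nat :=
  #|[set e in E | v \in e]|.

Definition odd_vertices (V : finType) (S : {set V}) (E : {set {set V}}) : {set V} :=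
  [set v in S | odd (degree E v)].

(* Connected and acyclic; a [ucycle] x, y of size 2 goes back and forth along
   one edge, so only those of size at least 3 are cycles of the graph.        *)
Definition spanning_tree (V : finType) (S : {set V}) (T : {set {set V}}) : Prop :=
  [/\ forall e, e \in T -> #|e| = 2%N /\ e \subset S,
      forall x y, x \in S -> y \in S -> connect (adj T) x y
    & forall c, ucycle (adj T) c -> (size c <= 2)%N].

Definition min_spanning_tree (R : realFieldType) (V : finType)
    (d : V -> V -> R) (S : {set V}) (T : {set {set V}}) : Prop :=
  spanning_tree S T /\
  forall T', spanning_tree S T' -> graph_len d T <= graph_len d T'.

Definition perfect_matching (V : finType) (S : {set V}) (M : {set {set V}}) : Prop :=
  partition M S /\ forall e, e \in M -> #|e| = 2%N.

Definition min_perfect_matching (R : realFieldType) (V : finType)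
    (d : V -> V -> R) (S : {set V}) (M : {set {set V}}) : Prop :=
  perfect_matching S M /\
  forall M', perfect_matching S M' -> graph_len d M <= graph_len d M'.

Definition eulerian_circuit (V : finType) (E : seq {set V}) (w : seq V) : Prop :=
  perm_eq (closed_steps (fun x y => [set x; y]) w) E.

(* [c] is a possible output of the algorithm on the complete graph on S, for
   some choice of the minimum spanning tree T, of the minimum perfect matching
   M of its odd-degree vertices, of the Eulerian circuit w of the multigraph
   T + M (an edge in both T and M is doubled), and of the shortcutting, which
   keeps exactly one occurrence in w of each vertex of S.                     *)
Definition christofides (R : realFieldType) (V : finType)
    (d : V -> V -> R) (S : {set V}) (c : seq V) : Prop :=
  exists (T M : {set {set V}}) (w : seq V),
    [/\ min_spanning_tree d S T,
        min_perfect_matching d (odd_vertices S T) M,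
        eulerian_circuit (enum T ++ enum M) w,
        subseq c w
      & hamilton_cycle S c].

(** Schedules.  Teams are the naturals t < n and slots the naturals s < 2n - 2;
    values outside these ranges are irrelevant.                               *)
Record schedule := Schedule {
  opponent : nat -> nat -> nat;  (* team, slot *)
  at_home : nat -> nat -> bool   (* team, slot *)
}.

(* [venue t] is the home venue of team t.                                     *)
Definition game_venue (V : Type) (venue : nat -> V) (K : schedule) (t s : nat) : V :=
  if at_home K t s then venue t else venue (opponent K t s).

Definition team_distance (R : nmodType) (V : Type) (d : V -> V -> R)
    (venue : nat -> V) (n : nat) (K : schedule) (t : nat) : R :=
  closed_len d (venue t :: [seq game_venue venue K t s | s <- iota 0 (2 * n - 2)]).

Definition total_distance (R : nmodType) (V : Type) (d : V -> V -> R)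
    (venue : nat -> V) (n : nat) (K : schedule) : R :=
  \sum_(t < n) team_distance d venue n K t.

(* Adding n - 1 makes the truncated subtraction agree with s - t modulo n - 1
   for t < n - 1.                                                             *)
Definition Kstar (n t s : nat) : nat :=
  if t == n.-1 then (if odd s then (s + n.-1) %/ 2 else s %/ 2)%N
  else if (s + n.-1 - t == t %[mod n.-1])%N then n.-1
  else ((s + n.-1 - t) %% n.-1)%N.

Definition Kstar_home (n t s : nat) : bool :=
  if (t < n %/ 2)%N then (2 * t <= s <= n + 2 * t - 2)%N
  else if (t < n.-1)%N then ~~ (2 * t - n + 2 <= s <= 2 * t)%N
  else (n.-1 <= s)%N.

Definition KstarDRR (n : nat) : schedule :=
  {| opponent := fun t s => Kstar n t (s %% n.-1);
     at_home := Kstar_home n |}.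

Definition KstarDRR_shift (n m : nat) : schedule :=
  {| opponent := fun t s => opponent (KstarDRR n) t ((s + m) %% (2 * n - 2));
     at_home := fun t s => at_home (KstarDRR n) t ((s + m) %% (2 * n - 2)) |}.

(* Team i < n - 1 lives at the i-th vertex of [c], team n - 1 at [vstar]
   (when [size c = n - 1]).                                                   *)
Definition team_venue (V : Type) (c : seq V) (vstar : V) (i : nat) : V :=
  nth vstar (rcons c vstar) i.

(* Main.v *)
(** Put q = n - 1.  Cyclically in time, each team spends q consecutive slots at
    home and then q slots away.  Let L be the length of the corresponding closed
    tour of a team with home venue v.  Starting the schedule in an away slot
    only replaces the move x -> y into that slot by x -> v -> y, so over all 2q
    rotations the team travels at most 2q L + 2 sum_v' d(v, v'); summed over the
    teams and averaged, the second term gives the last term of the bound.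

    Up to rotation, the tour of team t < n/2 is the cycle c with vstar inserted
    between v_t and v_(t+1), and the tour of team n/2 <= t < q is c with vstar
    inserted between v_(t-1) and v_t.  So over these q teams each gap of c except
    the one from v_(q-1) to v_0 is used once, and the gap after v_(n/2-1) twice.
    Once around c the detours to vstar add up to 2 sum_v d(v, vstar) - tau', and
    the repeated one is at most tau, because two vertices are at distance at most
    tau / 2 (they cut a shortest Hamilton cycle into two walks).  For the same
    reason the n moves of team q cost at most n tau / 2. *)
Require Import Defs.
From mathcomp Require Import all_boot all_order all_algebra.
From mathcomp Require Import zify ring lra.
Import Order.TTheory GRing.Theory Num.Theory.
Local Open Scope ring_scope.

(** * Sums over one period *)

Lemma big_nat_periodic (R : zmodType) (f : nat -> R) (p a : nat) :
  (forall i, f (i + p)%N = f i) ->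
  \sum_(a <= i < a + p) f i = \sum_(0 <= i < p) f i.
Proof.
move=> fp; elim: a => [|a IHa]; first by rewrite add0n.
case: p fp IHa => [|p] fp IHa; first by rewrite addn0 !big_geq.
rewrite -IHa addSn big_nat_recr ?leq_addr; last by lia.
by rewrite [in RHS]big_ltn ?fp /= 1?addrC //; lia.
Qed.

Lemma big_nat_offset (R : nmodType) (f : nat -> R) (a k : nat) :
  \sum_(a <= i < a + k) f i = \sum_(0 <= i < k) f (a + i)%N.
Proof.
rewrite -{1}[a]addn0 [(a + 0)%N]addnC big_addn addKn.
by apply: eq_bigr => i _; rewrite addnC.
Qed.

(** * Lengths of closed walks and of rotated schedules *)

Section Walks.
Variables (R : realFieldType) (V : Type) (d : V -> V -> R).

Lemma sum_pairmap_rcons (x : nat -> V) (a k : nat) (z : V) :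
  \sum_(l <- pairmap d (x a) (rcons [seq x i | i <- iota a.+1 k] z)) l
  = \sum_(a <= i < a + k) d (x i) (x i.+1) + d (x (a + k)%N) z.
Proof.
elim: k a => [|k IHk] a /=; first by rewrite addn0 big_geq // big_seq1 add0r.
by rewrite big_cons IHk [in RHS]big_ltn ?addSnnS ?addrA //; lia.
Qed.

Lemma closed_len_cons (v : V) (x : nat -> V) (a k : nat) :
  closed_len d (v :: [seq x i | i <- iota a k.+1])
  = d v (x a) + \sum_(a <= i < a + k) d (x i) (x i.+1) + d (x (a + k)%N) v.
Proof. by rewrite /closed_len /= big_cons sum_pairmap_rcons addrA. Qed.

Lemma closed_len_rcons (v : V) (w : seq V) :
  closed_len d (rcons w v) = closed_len d (v :: w).
Proof.
case: w => // x w; rewrite /closed_len /= big_cons.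
have -> y z u : \sum_(l <- pairmap d y (rcons (rcons w z) u)) l
               = d z u + \sum_(l <- pairmap d y (rcons w z)) l.
  elim: w y => [|b w IHw] y /=; first by rewrite !big_cons !big_nil !addr0 addrC.
  by rewrite !big_cons IHw addrCA.
by [].
Qed.

Lemma closed_len_nth (x0 : V) (w : seq V) :
  closed_len d w
  = \sum_(0 <= i < size w) d (nth x0 w (i %% size w)) (nth x0 w (i.+1 %% size w)).
Proof.
case: w => [|v w]; first by rewrite /closed_len /= !(big_nil, big_geq).
have {1}->: v :: w = [seq nth x0 (v :: w) i | i <- iota 0 (size w).+1].
  by rewrite -[iota _ _]/(iota 0 (size (v :: w))) -/(mkseq _ _) mkseq_nth.
rewrite /closed_len /= (sum_pairmap_rcons (nth x0 (v :: w))) add0n.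
rewrite big_nat_recr //= modnn modn_small //; congr (_ + _).
by rewrite !big_nat; apply: eq_bigr => i lt_i; rewrite !modn_small //; lia.
Qed.

Lemma closed_len_le (D : R) (w : seq V) : (forall x y, d x y <= D) ->
  closed_len d w <= (size w)%:R * D.
Proof.
case: w => [|v w] d_le; first by rewrite /closed_len /= big_nil mul0r.
rewrite (closed_len_nth v) mulr_natl -[size (v :: w)]subn0 -sumr_const_nat.
by apply: ler_sum => i _; rewrite subn0.
Qed.

Hypotheses (d_ge0 : forall x y, 0 <= d x y) (d_refl : forall x, d x x = 0).
Hypothesis d_sym : forall x y, d x y = d y x.
Hypothesis d_triangle : forall x y z, d x z <= d x y + d y z.

Lemma dist_le_walk (x : nat -> V) (a b : nat) : (a <= b)%N ->
  d (x a) (x b) <= \sum_(a <= i < b) d (x i) (x i.+1).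
Proof.
elim: b => [|b IHb]; first by rewrite leqn0 => /eqP->; rewrite d_refl big_geq.
rewrite leq_eqVlt => /predU1P[-> | le_ab]; first by rewrite d_refl big_geq.
rewrite big_nat_recr //=; apply: le_trans (d_triangle _ (x b) _) _.
by rewrite lerD2r IHb.
Qed.

(** Positions [i] and [j] cut the closed walk into two walks, and by the triangle inequality each is
    at least as long as the distance between the two vertices. *)
Lemma dist_le_half_closed_len (x0 : V) (w : seq V) (i j : nat) :
  (i < size w)%N -> (j < size w)%N ->
  d (nth x0 w i) (nth x0 w j) <= closed_len d w / 2.
Proof.
wlog le_ij: i j / (i <= j)%N => [H|].
  by case: (leqP i j) => [|/ltnW] le_ij lt_i lt_j; last rewrite d_sym; apply: H.
move=> lt_i lt_j; rewrite (closed_len_nth x0).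
set x := fun k => nth x0 w (k %% size w).
have xp k : x (k + size w)%N = x k by rewrite /x modnDr.
rewrite -(@big_nat_periodic _ (fun k => d (x k) (x k.+1)) _ i); last first.
  by move=> k; rewrite -addSn !xp.
have -> : nth x0 w i = x i by rewrite /x modn_small.
have -> : nth x0 w j = x j by rewrite /x modn_small.
rewrite (@big_cat_nat _ _ _ j) //=; last by lia.
have := dist_le_walk x _ _ le_ij.
have /(dist_le_walk x) : (j <= i + size w)%N by lia.
rewrite xp (d_sym (x j)); lra.
Qed.

(* [x] lists the venues of a team slot by slot, [v] is its home venue, and [a]
   the first slot of its home stand. *)
Lemma sum_shifts (x z : nat -> V) (v : V) (q a : nat) :
  (0 < q)%N -> (forall i, x (i + 2 * q)%N = x i) ->
  (forall j, (j < q)%N -> x (a + j)%N = v) ->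
  (forall k, (k < q)%N -> x (a + q + k)%N = z k) ->
  \sum_(m < 2 * q) closed_len d (v :: [seq x (s + m)%N | s <- iota 0 (2 * q)])
  <= (2 * q)%:R * closed_len d (v :: mkseq z q)
     + 2 * \sum_(0 <= k < q) d v (z k).
Proof.
case: q => // q _ xp home away; set p := (2 * q.+1)%N in xp *.
have pE : p = (q.+1 + q.+1)%N by rewrite /p; lia.
clearbody p.
pose L := \sum_(0 <= i < p) d (x i) (x i.+1).
have stepp i : d (x (i + p)%N) (x (i + p).+1) = d (x i) (x i.+1).
  by rewrite -addSn !xp.
(* Moves within the home stand have length 0, so one full period is the tour from home through the
   away venues and back. *)
have L_tour : L = closed_len d (v :: mkseq z q.+1).
  rewrite /L -(big_nat_periodic _ _ _ a stepp) closed_len_cons add0n.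
  rewrite (@big_cat_nat _ _ _ (a + q)) /=; [|lia|lia].
  rewrite big_nat big1 => [|i lt_i]; last first.
    rewrite -(subnKC (n := i) (m := a)); last by lia.
    by rewrite -addnS !home ?d_refl //; lia.
  rewrite add0r big_ltn; last by lia.
  rewrite home // -addnS -[X in x X]addn0 away // -addrA; congr (_ + _).
  have -> : (a + p = (a + q.+1 + q).+1)%N by lia.
  rewrite big_nat_recr; last by lia.
  rewrite away //; congr (_ + d _ _); last first.
    have -> : ((a + q.+1 + q).+1 = a + 0 + p)%N by lia.
    by rewrite xp home.
  rewrite big_nat_offset !big_nat; apply: eq_bigr => i lt_i.
  by rewrite -addnS !away //; lia.
have D_tour : \sum_(0 <= i < p) d v (x i) = \sum_(0 <= k < q.+1) d v (z k).
  rewrite -(@big_nat_periodic _ _ _ a) => [|i]; last by rewrite xp.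
  rewrite (@big_cat_nat _ _ _ (a + q.+1)) /=; [|lia|lia].
  rewrite big_nat big1 => [|i lt_i]; last first.
    rewrite -(subnKC (n := i) (m := a)); last by lia.
    by rewrite home ?d_refl //; lia.
  have -> : (a + p = a + q.+1 + q.+1)%N by lia.
  rewrite add0r big_nat_offset !big_nat.
  by apply: eq_bigr => i lt_i; rewrite away.
(* The season starting in slot [m] replaces the move that closes the period by a trip through [v];
   the nonnegative length of the replaced move is dropped. *)
have shift_le m : closed_len d (v :: [seq x (s + m)%N | s <- iota 0 p])
    <= L + (d v (x m) + d v (x (m + p.-1)%N)).
  have : \sum_(m <= i < m + p) d (x i) (x i.+1) = L by apply: big_nat_periodic.
  rewrite (_ : (m + p = (m + p.-1).+1)%N); last by lia.
  rewrite big_nat_recr /=; last by lia.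
  move<-; have -> : [seq x (s + m)%N | s <- iota 0 p] = [seq x s | s <- iota m p].
    by rewrite -{2}[m]addn0 iotaDl -map_comp; apply: eq_map => s; rewrite /= addnC.
  rewrite (_ : iota m p = iota m p.-1.+1); last by congr iota; lia.
  rewrite closed_len_cons.
  rewrite (d_sym _ v).
  have := d_ge0 (x (m + p.-1)%N) (x (m + p.-1).+1); lra.
apply: (@le_trans _ _ (\sum_(m < p) (L + (d v (x m) + d v (x (m + p.-1)%N))))).
  by apply: ler_sum => m _; apply: shift_le.
(* Both the first and the last slot of the rotated season run over a full period, hence the factor
   2. *)
rewrite big_split /= sumr_const card_ord big_split /= -L_tour mulr_natl lerD2l.
rewrite -(big_mkord xpredT (fun m => d v (x m))) D_tour.
rewrite -(big_mkord xpredT (fun m => d v (x (m + p.-1)%N))).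
under [X in _ + X <= _]eq_bigr do rewrite addnC.
rewrite -(big_nat_offset _ (fun i => d v (x i))) (big_nat_periodic _ _ p) => [|i].
   by rewrite /= D_tour mulrDl !mul1r.
by rewrite xp.
Qed.

End Walks.

(** * Opponents and home stands in [KstarDRR] *)

(** Opponent and [t] add up to the slot modulo [q], so from slot [2 * t] on the opponents would be
    [t], [t + 1], and so on; the first is the team itself and gives way to team [q]. *)
Lemma Kstar_cycle (q t k i : nat) : (t < q)%N -> (k < q)%N ->
  (i = 2 * t + k %[mod q])%N ->
  Kstar q.+1 t (i %% q) = (if k == 0 then q else (t + k) %% q)%N.
Proof.
move=> lt_t lt_k ik; rewrite /Kstar /= (ltn_eqF lt_t).
have le_t : (t <= i %% q + q)%N by lia.
rewrite -(eqn_modDr t) subnK // modnDr modn_mod ik mul2n -addnn.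
rewrite -{2}[(t + t)%N]addn0 eqn_modDl mod0n modn_small //.
case: eqP => // _; apply/eqP; rewrite -(eqn_modDr t) subnK; last by lia.
by rewrite modnDr modn_mod addnAC.
Qed.

Lemma Kstar_home_low (q t j : nat) : odd q -> (t < q.+1 %/ 2)%N -> (j < 2 * q)%N ->
  Kstar_home q.+1 t ((2 * t + j) %% (2 * q)) = (j < q)%N.
Proof.
move=> q_odd lt_t lt_j; rewrite /Kstar_home lt_t.
have [lt_s | le_s] := ltnP (2 * t + j) (2 * q); first by rewrite modn_small //; lia.
by rewrite -(subnK le_s) modnDr modn_small; lia.
Qed.

(** The away stand ends in slot [2 * t], so the home stand starts one slot later and wraps around
    the end of the season. *)
Lemma Kstar_home_high (q t j : nat) : odd q -> (q.+1 %/ 2 <= t < q)%N ->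
  (j < 2 * q)%N ->
  Kstar_home q.+1 t (((2 * t).+1 + j) %% (2 * q)) = (j < q)%N.
Proof.
move=> q_odd lt_t lt_j; rewrite /Kstar_home.
have -> : (t < q.+1 %/ 2)%N = false by lia.
have -> : (t < q.+1.-1)%N by lia.
have [lt_s | le_s] := ltnP ((2 * t).+1 + j) (2 * q).
  by rewrite modn_small //; lia.
by rewrite -(subnK le_s) modnDr modn_small; lia.
Qed.

Lemma Kstar_home_last (q j : nat) : (j < 2 * q)%N ->
  Kstar_home q.+1 q ((q + j) %% (2 * q)) = (j < q)%N.
Proof.
move=> lt_j; rewrite /Kstar_home /= ltnn.
have -> : (q < q.+1 %/ 2)%N = false by lia.
have [lt_s | le_s] := ltnP (q + j) (2 * q); first by rewrite modn_small //; lia.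
by rewrite -(subnK le_s) modnDr modn_small; lia.
Qed.

(** * Tours of the individual teams over all rotations *)

Section Tournament.
Variables (R : realFieldType) (V : finType) (d : V -> V -> R).
Hypotheses (d_ge0 : forall x y, 0 <= d x y) (d_refl : forall x, d x x = 0).
Hypothesis d_sym : forall x y, d x y = d y x.
Hypothesis d_triangle : forall x y z, d x z <= d x y + d y z.
Variables (q : nat) (q_ge3 : (3 <= q)%N) (q_odd : odd q).
Variables (vstar : V) (c : seq V).
Hypotheses (size_c : size c = q) (uniq_venues : uniq (rcons c vstar)).

Local Notation venue := (team_venue c vstar).
Local Notation P k := (nth vstar c (k %% q)).

Let venue_cycle t : (t < q)%N -> venue t = P t.
Proof. by move=> lt_t; rewrite /team_venue nth_rcons size_c lt_t modn_small. Qed.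

Let venue_last : venue q = vstar.
Proof. by rewrite /team_venue nth_rcons size_c ltnn eqxx. Qed.

(** Here [a] is the first home slot and [o] lists the opponents of the away stand. They are
    distinct, so the distances from home to the away venues add up to at most the sum over all other
    venues. *)
Lemma team_shifts (t a : nat) (o : nat -> nat) : (t <= q)%N ->
  (forall j, (j < 2 * q)%N -> Kstar_home q.+1 t ((a + j) %% (2 * q)) = (j < q)%N) ->
  (forall k, (k < q)%N -> Kstar q.+1 t ((a + q + k) %% q) = o k) ->
  {in gtn q &, injective o} -> (forall k, (k < q)%N -> (o k <= q)%N) ->
  \sum_(m < 2 * q) team_distance d venue q.+1 (KstarDRR_shift q.+1 m) t
  <= (2 * q)%:R * closed_len d (venue t :: mkseq (fun k => venue (o k)) q)
     + 2 * \sum_(v' | v' != venue t) d (venue t) v'.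
Proof.
move=> le_t home opp o_inj o_le.
pose x i := game_venue venue (KstarDRR q.+1) t (i %% (2 * q)).
have -> : \sum_(m < 2 * q) team_distance d venue q.+1 (KstarDRR_shift q.+1 m) t
   = \sum_(m < 2 * q)
       closed_len d (venue t :: [seq x (s + m)%N | s <- iota 0 (2 * q)]).
  apply: eq_bigr => m _; rewrite /team_distance.
  have {1}-> : (2 * q.+1 - 2 = 2 * q)%N by lia.
  congr (closed_len d (_ :: _)); apply: eq_map => s.
  rewrite /x /game_venue /=.
  by have -> : (2 * q.+1 - 2 = 2 * q)%N by lia.
pose z k := venue (o k).
apply: le_trans (@sum_shifts _ _ d d_ge0 d_refl d_sym x z (venue t) q a _ _ _ _) _.
- by lia.
- by move=> i; rewrite /x modnDr.
- by move=> j lt_j; rewrite /x /game_venue /= home ?lt_j //; lia.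
- move=> k lt_k; rewrite /x /game_venue /= -addnA home; last by lia.
  by rewrite ltnNge leq_addr /= addnA modn_dvdm ?opp // dvdn_mull.
rewrite lerD2l ler_pM2l // -(big_map z xpredT (d (venue t))).
have uniq_z : uniq (map z (index_iota 0 q)).
  rewrite /index_iota subn0; apply/mkseq_uniqP => i j lt_i lt_j /eqP.
  rewrite nth_uniq // ?size_rcons ?size_c ?ltnS ?o_le // => /eqP.
  exact: o_inj.
rewrite big_uniq //=; apply: (@le_trans _ _ (\sum_v' d (venue t) v')).
  by rewrite big_mkcond; apply: ler_sum => v' _; case: ifP.
by rewrite (bigD1 (venue t)) //= d_refl add0r.
Qed.

Let tau' := closed_len d c.

Let P_add t : P (t + q) = P t.
Proof. by rewrite modnDr. Qed.

Lemma cycle_len_window (t : nat) :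
  tau' = \sum_(t <= i < t + q) d (P i) (P i.+1).
Proof.
rewrite /tau' (closed_len_nth _ _ d vstar) size_c -(big_nat_periodic _ _ q t) // => i.
by rewrite -addSn !P_add.
Qed.

(* Extra length of the cycle when [vstar] is inserted after vertex [t]. *)
Let detour t := d (P t) vstar + d (P t.+1) vstar - d (P t) (P t.+1).

(** In the window of the cycle that starts at [t], the step out of [P t] becomes two steps through
    [vstar]. *)
Lemma closed_len_insert (t : nat) :
  closed_len d (vstar :: [seq P i | i <- iota t.+1 q]) = tau' + detour t.
Proof.
rewrite (cycle_len_window t).
rewrite (_ : iota t.+1 q = iota t.+1 q.-1.+1); last by congr iota; lia.
rewrite (closed_len_cons _ _ d vstar (fun i => P i)).
rewrite [in RHS]big_ltn; last by lia.
rewrite (_ : (t.+1 + q.-1 = t + q)%N); last by lia.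
by rewrite P_add (d_sym vstar) /detour; ring.
Qed.

(** The away stand starts in a slot congruent to [2 * t] modulo [q], so [vstar] is visited first,
    right after home: it fills the gap after [P t]. *)
Lemma low_team_shifts (t : nat) : (t < q.+1 %/ 2)%N ->
  \sum_(m < 2 * q) team_distance d venue q.+1 (KstarDRR_shift q.+1 m) t
  <= (2 * q)%:R * (tau' + detour t)
     + 2 * \sum_(v' | v' != venue t) d (venue t) v'.
Proof.
move=> lt_t; have lt_tq : (t < q)%N by lia.
apply: le_trans (@team_shifts t (2 * t)
  (fun k => if k == 0 then q else (t + k) %% q)%N _ _ _ _ _) _.
- by lia.
- by move=> j lt_j; apply: Kstar_home_low.
- by move=> k lt_k; apply: Kstar_cycle => //; rewrite addnAC modnDr.
- move=> i j; rewrite !inE => lt_i lt_j.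
  have lt_mod k : ((t + k) %% q < q)%N by rewrite ltn_mod; lia.
  have := lt_mod i; have := lt_mod j.
  case: eqP => [-> | _]; case: eqP => [-> | _] //; try by lia.
  by move=> _ _ /eqP; rewrite eqn_modDl !modn_small // => /eqP.
- by move=> k lt_k; case: ifP => // _; rewrite ltnW // ltn_mod; lia.
rewrite lerD2r ler_wpM2l ?ler0n // -closed_len_insert.
rewrite (_ : iota t.+1 q = rcons (iota t.+1 q.-1) (t + q)%N); last first.
  rewrite (_ : iota t.+1 q = iota t.+1 (q.-1 + 1)); last by congr iota; lia.
  by rewrite iotaD cats1; congr rcons; lia.
(* Rotating the closed walk brings the home venue [P t] from the end to the front. *)
rewrite map_rcons -rcons_cons closed_len_rcons P_add -venue_cycle //.
rewrite /mkseq (_ : iota 0 q = 0%N :: iota 1 q.-1); last first.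
  by rewrite -[RHS]/(iota 0 q.-1.+1); congr iota; lia.
rewrite /= venue_last -(addn1 t) iotaDl -map_comp.
rewrite le_eqVlt; apply/predU1P; left; congr (closed_len d (_ :: _ :: _)).
apply/eq_in_map => k; rewrite mem_iota => /andP[k_gt0 _] /=.
by rewrite -[k == 0]negbK -lt0n k_gt0 venue_cycle ?modn_mod // ltn_mod; lia.
Qed.

(** The away stand starts one slot after the residue [2 * t] modulo [q], so [vstar] is visited last,
    right before the return home: it fills the gap before [P t]. *)
Lemma high_team_shifts (t : nat) : (q.+1 %/ 2 <= t < q)%N ->
  \sum_(m < 2 * q) team_distance d venue q.+1 (KstarDRR_shift q.+1 m) t
  <= (2 * q)%:R * (tau' + detour t.-1)
     + 2 * \sum_(v' | v' != venue t) d (venue t) v'.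
Proof.
move=> lt_t; have lt_tq : (t < q)%N by lia.
apply: le_trans (@team_shifts t (2 * t).+1
  (fun k => if k == q.-1 then q else (t + k.+1) %% q)%N _ _ _ _ _) _.
- by lia.
- by move=> j lt_j; apply: Kstar_home_high.
- move=> k lt_k; case: eqP => [-> | neq_k].
    (* The last away slot is congruent to [2 * t] modulo [q], where team [q] is met. *)
    rewrite (@Kstar_cycle q t 0) //; first by lia.
    rewrite (_ : ((2 * t).+1 + q + q.-1 = 2 * t + 0 + q + q)%N); last by lia.
    by rewrite !modnDr.
  rewrite (@Kstar_cycle q t k.+1) //; first by lia.
  rewrite (_ : ((2 * t).+1 + q + k = 2 * t + k.+1 + q)%N); last by lia.
  by rewrite modnDr.
- move=> i j; rewrite !inE => lt_i lt_j.
  have lt_mod k : ((t + k) %% q < q)%N by rewrite ltn_mod; lia.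
  have := lt_mod i.+1; have := lt_mod j.+1.
  case: eqP => [-> | neq_i]; case: eqP => [-> | neq_j] //; try by lia.
  by move=> _ _ /eqP; rewrite eqn_modDl !modn_small => [/eqP [] //||]; lia.
- by move=> k lt_k; case: ifP => // _; rewrite ltnW // ltn_mod; lia.
rewrite lerD2r ler_wpM2l ?ler0n // -closed_len_insert.
rewrite prednK; last by lia.
rewrite -(closed_len_rcons _ _ d vstar) /mkseq.
rewrite (_ : iota 0 q = rcons (iota 0 q.-1) q.-1); last first.
  rewrite (_ : iota 0 q = iota 0 (q.-1 + 1)); last by congr iota; lia.
  by rewrite iotaD cats1.
rewrite map_rcons eqxx venue_last.
rewrite (_ : iota t q = t :: iota t.+1 q.-1); last first.
  by rewrite -[RHS]/(iota t q.-1.+1); congr iota; lia.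
rewrite /= venue_cycle // -(addn0 t.+1) iotaDl -map_comp.
rewrite le_eqVlt; apply/predU1P; left.
congr (closed_len d (_ :: rcons _ _)); apply/eq_in_map => k; rewrite mem_iota => /andP[_ lt_k] /=.
rewrite ifF; last by lia.
by rewrite venue_cycle ?modn_mod ?addnS ?addSn // ltn_mod; lia.
Qed.

Lemma last_team_shifts (D : R) : (forall x y, d x y <= D) ->
  \sum_(m < 2 * q) team_distance d venue q.+1 (KstarDRR_shift q.+1 m) q
  <= (2 * q)%:R * (q.+1%:R * D)
     + 2 * \sum_(v' | v' != venue q) d (venue q) v'.
Proof.
move=> d_le.
apply: le_trans (@team_shifts q q (Kstar q.+1 q) _ _ _ _ _) _ => //.
- by move=> j lt_j; apply: Kstar_home_last.
- by move=> k lt_k; rewrite addnC addnA !modnDr modn_small.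
- move=> i j; rewrite !inE /Kstar eqxx => lt_i lt_j.
  (* Even slots give opponents up to [(q - 1) / 2], odd slots give opponents from [(q + 1) / 2]
     on. *)
  by case: ifP; case: ifP; lia.
- by move=> k lt_k; rewrite /Kstar eqxx; case: ifP; lia.
rewrite lerD2r ler_wpM2l ?ler0n //.
(* Home and the [q] away venues form a closed walk of [q.+1] moves. *)
by apply: le_trans (closed_len_le _ _ _ _ _ d_le) _; rewrite /= size_mkseq.
Qed.

(** * Summing over the teams and assembling the bound *)

Lemma sum_venues (F : V -> R) : c =i [set~ vstar] ->
  \sum_v F v = \sum_(0 <= t < q.+1) F (venue t).
Proof.
move=> cE; have -> : q.+1 = size (rcons c vstar) by rewrite size_rcons size_c.
rewrite -(big_nth vstar xpredT F) [in RHS]big_uniq //=; apply: eq_bigl => v.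
by rewrite mem_rcons inE cE !inE; case: eqP.
Qed.

Lemma sum_detours (D : R) : (forall x y, d x y <= D) ->
  \sum_(0 <= t < q) detour (if (t < q.+1 %/ 2)%N then t else t.-1)
  <= 2 * (\sum_(0 <= t < q) d (P t) vstar) - tau' + 2 * D.
Proof.
move=> d_le; set k := (q.+1 %/ 2)%N.
have k_gt1 : (1 < k)%N by rewrite /k; lia.
have lt_kq : (k < q)%N by rewrite /k; lia.
have detour_ge0 t : 0 <= detour t.
  by rewrite subr_ge0 (d_sym (P t.+1)).
have detour_le t : detour t <= 2 * D.
  have := d_le (P t) vstar; have := d_le (P t.+1) vstar.
  by have := d_ge0 (P t) (P t.+1); rewrite /detour; lra.
(* The low teams take the gaps from 0 to [k.-1], the high teams those from [k.-1] to [q - 2]. *)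
have -> : \sum_(0 <= t < q) detour (if (t < k)%N then t else t.-1)
          = \sum_(0 <= t < q.-1) detour t + detour k.-1.
  rewrite (@big_cat_nat _ _ _ k) //=; last by lia.
  rewrite [in RHS](@big_cat_nat _ _ _ k.-1) //=; last by lia.
  rewrite addrAC; congr (_ + _).
    rewrite -{1}[k]prednK; last by lia.
    rewrite big_nat_recr //= ifT; last by lia.
    congr (_ + _); rewrite !big_nat; apply: eq_bigr => t lt_t.
    by rewrite ifT //; lia.
  rewrite -{1}[k]prednK; last by lia.
  rewrite big_add1 !big_nat; apply: eq_bigr => t lt_t.
  by rewrite ifF //; lia.
(* Once around, each vertex of [c] contributes its distance to [vstar] twice, and each edge of [c]
   is subtracted once. *)
have : \sum_(0 <= t < q.-1) detour t + detour q.-1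
       = 2 * (\sum_(0 <= t < q) d (P t) vstar) - tau'.
  rewrite -big_nat_recr //= prednK; last by lia.
  rewrite /detour sumrB big_split /= (cycle_len_window 0) add0n.
  pose e t := d (P t) vstar.
  rewrite -(big_add1 _ _ 0 q.+1 xpredT e) -[q.+1]/(1 + q)%N.
  rewrite (big_nat_periodic _ e q 1) => [|i]; last by rewrite /e P_add.
  by ring.
have := detour_ge0 q.-1; have := detour_le k.-1; lra.
Qed.

End Tournament.

Theorem theorem1 (R : realFieldType) (n : nat) (n_ge4 : (4 <= n)%N)
    (n_even : ~~ odd n) (V : finType) (cardV : #|V| = n)
    (d : V -> V -> R)
    (d_ge0 : forall x y, 0 <= d x y)
    (d_refl : forall x, d x x = 0)
    (d_sym : forall x y, d x y = d y x)
    (d_triangle : forall x y z, d x z <= d x y + d y z)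
    (vstar : V)
    (vstar_min : forall v, \sum_(v' | v' != vstar) d vstar v'
                           <= \sum_(v' | v' != v) d v v')
    (c : seq V) (c_christofides : christofides d [set~ vstar] c)
    (h : seq V) (h_shortest : shortest_hamilton_cycle d [set: V] h) :
  let tau := closed_len d h in
  let tau' := closed_len d c in
  (\sum_(m < 2 * n - 2)
      total_distance d (team_venue c vstar) n (KstarDRR_shift n m))
    / (2 * n - 2)%:R
  <= (n - 2)%:R * tau'
     + 2 * \sum_(v | v != vstar) d v vstar
     + 3 / 2 * tau
     + n%:R * tau / 2
     + 1 / (n - 1)%:R * \sum_v \sum_(v' | v' != v) d v v'.
Proof.
cbv zeta; set tau := closed_len d h; set tau' := closed_len d c.
have [_ [_ [_ [_ _ _ _ [uniq_c cE]]]]] := c_christofides.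
have [[uniq_h hE] _] := h_shortest.
case: n => // q in n_ge4 n_even cardV *.
have q_odd : odd q by rewrite /= negbK in n_even.
have size_c : size c = q.
  by rewrite -(card_uniqP uniq_c) (eq_card cE) cardsC1 cardV.
have uniq_venues : uniq (rcons c vstar).
  by rewrite rcons_uniq uniq_c cE !inE eqxx.
(* Both venues lie on the Hamilton cycle [h]; [tau / 2] serves as the constant [D] of the lemmas
   above. *)
have d_le x y : d x y <= tau / 2.
  rewrite -(nth_index x (_ : x \in h)) ?hE ?inE //.
  rewrite -(nth_index x (_ : y \in h)) ?hE ?inE //.
  by apply: dist_le_half_closed_len; rewrite ?index_mem ?hE ?inE.
rewrite (_ : (2 * q.+1 - 2 = 2 * q)%N); last by lia.
have q_gt0 : (0 < q%:R :> R) by rewrite ltr0n; lia.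
pose venue := team_venue c vstar.
pose D v := \sum_(v' | v' != v) d v v'.
pose P t := nth vstar c (t %% q).
pose detour t := d (P t) vstar + d (P t.+1) vstar - d (P t) (P t.+1).
(* [L t] bounds the length of the tour of team [t]. *)
pose L t := if (t < q)%N
  then tau' + detour (if (t < q.+1 %/ 2)%N then t else t.-1)
  else q.+1%:R * (tau / 2).
have team_le t : (t < q.+1)%N ->
    \sum_(m < 2 * q) team_distance d venue q.+1 (KstarDRR_shift q.+1 m) t
    <= (2 * q)%:R * L t + 2 * D (venue t).
  rewrite /L /D ltnS leq_eqVlt => /predU1P[-> | lt_t].
    by rewrite ltnn; apply: last_team_shifts.
  rewrite lt_t; case: ltnP => le_t; first by apply: low_team_shifts.
  by apply: high_team_shifts; rewrite ?le_t.
have sumL : \sum_(0 <= t < q.+1) L t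
    <= q%:R * tau' + (2 * (\sum_(0 <= t < q) d (P t) vstar) - tau' + 2 * (tau / 2))
       + q.+1%:R * (tau / 2).
  rewrite big_nat_recr //= {2}/L ltnn lerD2r.
  rewrite (eq_big_nat _ _ (F2 := fun t =>
    tau' + detour (if (t < q.+1 %/ 2)%N then t else t.-1))).
    rewrite big_split /= sumr_const_nat subn0 mulr_natl lerD2l.
    exact: sum_detours.
  by move=> t /andP[_ lt_t]; rewrite /L lt_t.
have sumD : \sum_(0 <= t < q.+1) D (venue t) = \sum_v D v.
  by rewrite (sum_venues _ _ q vstar c).
have sumE : \sum_(0 <= t < q) d (P t) vstar = \sum_(v | v != vstar) d v vstar.
  have := sum_venues _ _ _ vstar c size_c uniq_venues (d^~ vstar) cE.
  rewrite (bigD1 vstar) //= d_refl add0r => ->.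
  rewrite big_nat_recr //= /team_venue nth_rcons size_c ltnn eqxx d_refl addr0.
  rewrite !big_nat; apply: eq_bigr => t /andP[_ lt_t].
  by rewrite nth_rcons size_c lt_t /P modn_small.
rewrite /total_distance exchange_big /= ler_pdivrMr; last first.
  by rewrite ltr0n; lia.
apply: (@le_trans _ _ (\sum_(t < q.+1) ((2 * q)%:R * L t + 2 * D (venue t)))).
  by apply: ler_sum => t _; apply: team_le.
rewrite big_split /= -!mulr_sumr -(big_mkord xpredT L).
rewrite -(big_mkord xpredT (fun t => D (venue t))) sumD.
rewrite (_ : (q.+1 - 2)%:R = q%:R - 1 :> R); last first.
  by rewrite subSS natrB //; lia.
(* Multiplied by [2 * q], the last term of the claim is exactly twice the sum of [D]. *)
rewrite subSS subn0 natrM [leRHS]mulrDl lerD //; last first.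
  by rewrite /D le_eqVlt; apply/predU1P; left; field; rewrite gt_eqF.
rewrite [leRHS]mulrC ler_pM2l; last by rewrite mulr_gt0.
(* [sumL] yields [tau] where the claim has [3 / 2 * tau]; the difference [tau / 2] is
   nonnegative. *)
have tau_ge0 : 0 <= tau / 2 by apply: le_trans (d_le vstar vstar).
rewrite -sumE; apply: le_trans sumL _; lra.
Qed.
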